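(* Let $n=2^{a}$ where $a\ge 2$ is an integer. Let $s$ be an odd positive integer such that $s$ divides the central binomial coefficient $\binom{n}{n/2}$ and $s$ divides $\binom{n}{k}$ for some integer $k$ with $1\le k\le n-1$ and $k\ne n/2$. Then the cyclotomic polynomial $\Phi_{4s}(t)$ divides the descent set polynomial $Q_{n}(t)$.
   Context: For a permutation $\pi$ in the symmetric group $\mathfrak{S}_n$, its descent set is $\mathrm{Des}(\pi)=\{i\in[n-1] : \pi_i>\pi_{i+1}\}$, where $[n-1]=\{1,\dots,n-1\}$. For $S\subseteq[n-1]$ let $\beta_n(S)=|\{\pi\in\mathfrak{S}_n : \mathrm{Des}(\pi)=S\}|$. The $n$th descent set polynomial is $Q_n(t)=\sum_{S\subseteq[n-1]}t^{\beta_n(S)}$. $\Phi_m(t)$ denotes the $m$th cyclotomic polynomial; divisibility is in $\mathbb{Q}[t]$. *)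

(* Defs.v *)
From HB Require Import structures.
From mathcomp Require Import all_boot all_order all_algebra all_fingroup all_field.

Set Implicit Arguments.
Unset Strict Implicit.
Unset Printing Implicit Defensive.

Import GRing.Theory.

Local Open Scope ring_scope.

(* Indices and values are 0-based: [i : 'I_n.-1] stands for the position i + 1
   of [n-1], and pi_(i+1) is the value of [pi] at the ordinal i. As i < n - 1,
   the cyclic successor [ordS] does not wrap around here. *)
Definition descent_set (n : nat) (pi : 'S_n) : {set 'I_n.-1} :=
  [set i : 'I_n.-1 |
    let j : 'I_n := widen_ord (leq_pred n) i in (pi (ordS j) < pi j)%N].

Definition beta (n : nat) (S : {set 'I_n.-1}) : nat :=
  #|[set pi : 'S_n | descent_set pi == S]|.

Definition descent_set_poly (n : nat) : {poly rat} :=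
  \sum_(S : {set 'I_n.-1}) 'X^(@beta n S).

Definition Cyclotomic_rat (m : nat) : {poly rat} :=
  map_poly (intr : int -> rat) 'Phi_m.

(* Main.v *)
(* For [0 < k < n], choosing which k values occupy the first k positions shows
   that beta_n(S) + beta_n(S + {k}) = 'C(n, k) beta_k(S') beta_(n-k)(S''), where
   + is symmetric difference: a permutation whose descent set agrees with S
   away from k is a shuffle of two independent permutations.  For n = 2^a the
   left side is always even, so every beta_n(S) has the parity of
   beta_n(set0) = 1.  Hence, with k as in the theorem, toggling k negates
   beta_n(S) modulo 4s, whereas toggling n/2 negates it modulo s and sends it
   to 2 - beta_n(S) modulo 4, because 'C(n, n/2) is twice an odd number.
   Toggling both thus shifts beta_n(S) by 2s modulo 4s, which flips the sign of
   z ^ beta_n(S) for z a primitive (4s)-th root of unity, and Q_n(z) = 0. *)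
Require Import Defs.
From HB Require Import structures.
From mathcomp Require Import all_boot all_order all_algebra all_fingroup all_field.

Set Implicit Arguments.
Unset Strict Implicit.
Unset Printing Implicit Defensive.

(* Descent sets are cut out of predicates on [nat], with the 0-based positions
   of [descent_set], so that one predicate describes sets in ['I_n.-1] for
   several n without casts; toggling the paper's k is [flip k.-1]. *)
Definition pattern (n : nat) (D : pred nat) : {set 'I_n.-1} := [set i : 'I_n.-1 | D i].

Definition flip (i : nat) (D : pred nat) : pred nat :=
  fun j => D j (+) (j == i).

Lemma eq_pattern n (D D' : pred nat) : D =1 D' -> pattern n D = pattern n D'.
Proof. by move=> eqD; apply/setP=> i; rewrite !inE eqD. Qed.

Lemma in_descent_set n (pi : 'S_n) (i : 'I_n.-1) (x y : 'I_n) :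
  x = i :> nat -> y = i.+1 :> nat ->
  (i \in descent_set pi) = (pi y < pi x).
Proof.
move=> xi yi; rewrite inE; congr (pi _ < pi _); apply: val_inj => /=.
  by rewrite modn_small -?yi.
by rewrite xi.
Qed.

Lemma descent_set_patternP n (pi : 'S_n) (D : pred nat) :
  reflect (forall x y : 'I_n, y = x.+1 :> nat -> (pi y < pi x) = D x)
          (descent_set pi == pattern n D).
Proof.
apply: (iffP eqP) => [eqD x y yx | hD].
  have lt_x : x < n.-1 by rewrite ltn_predRL -yx.
  by rewrite -(@in_descent_set _ pi (Ordinal lt_x)) // eqD inE.
apply/setP=> i; have lt_i : i.+1 < n by rewrite -ltn_predRL.
rewrite (@in_descent_set _ pi i (Ordinal (ltnW lt_i)) (Ordinal lt_i)) //.
by rewrite hD // inE.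
Qed.

(** [enum A] filters the increasing list [enum 'I_n]. Relabelling a permutation by the elements of
    [A] therefore keeps its descents. *)
Lemma ltn_enum_val n (A : {set 'I_n}) (i j : 'I_#|A|) :
  (enum_val i < enum_val j) = (i < j).
Proof.
have sA : sorted ltn [seq val x | x <- enum A].
  have -> : enum A = [seq x <- enum 'I_n | x \in A] by rewrite enumT.
  rewrite sorted_map; apply: sorted_filter; first by move=> x y z; apply: ltn_trans.
  by rewrite -sorted_map val_enum_ord iota_ltn_sorted.
have x0 : 'I_n by apply: (enum_val i).
have szA : size [seq val x | x <- enum A] = #|A| by rewrite size_map -cardE.
have homo (p q : 'I_#|A|) : p < q -> enum_val p < enum_val q.
  move=> pq; rewrite !(enum_val_nth x0).
  rewrite -!(nth_map x0 (val x0) val) -?cardE //.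
  by apply: (sorted_ltn_nth ltn_trans) => //; rewrite inE szA.
case: (ltngtP i j) => [/homo -> // | /homo lt_ji | /val_inj->].
  by apply/negbTE; rewrite -leqNgt ltnW.
by rewrite ltnn.
Qed.

(** * Shuffles of two permutations and the toggling identity *)

Section Shuffle.
Variables k m : nat.
Notation ksubset := {A : {set 'I_(k + m)} | #|A| == k}.

Lemma card_ksubset (A : ksubset) : k = #|val A|.
Proof. by rewrite (eqP (valP A)). Qed.

Lemma card_ksubsetC (A : ksubset) : m = #|~: val A|.
Proof. by rewrite cardsCs setCK card_ord (eqP (valP A)) addKn. Qed.

(** [u.1] is the set of values taken on the first [k] positions; [u.2.1] and [u.2.2] are the
    relative orders of the two blocks. *)
Definition shuffle_fun (u : ksubset * ('S_k * 'S_m)) (i : 'I_(k + m)) :=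
  match split i with
  | inl x => enum_val (cast_ord (card_ksubset u.1) (u.2.1 x))
  | inr y => enum_val (cast_ord (card_ksubsetC u.1) (u.2.2 y))
  end.

Lemma shuffle_funl u x : shuffle_fun u (lshift m x) =
  enum_val (cast_ord (card_ksubset u.1) (u.2.1 x)).
Proof. by rewrite /shuffle_fun (unsplitK (inl x)). Qed.

Lemma shuffle_funr u y : shuffle_fun u (rshift k y) =
  enum_val (cast_ord (card_ksubsetC u.1) (u.2.2 y)).
Proof. by rewrite /shuffle_fun (unsplitK (inr y)). Qed.

Lemma shuffle_fun_mem u i : (shuffle_fun u i \in val u.1) = (i < k).
Proof.
rewrite -[i]splitK; case: (split i) => x /=.
  by rewrite shuffle_funl enum_valP ltn_ord.
rewrite shuffle_funr ltnNge leq_addr /=; apply/negbTE.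
by rewrite -in_setC enum_valP.
Qed.

Lemma shuffle_fun_inj u : injective (shuffle_fun u).
Proof.
move=> i j eq_ij; have := shuffle_fun_mem u i.
rewrite eq_ij shuffle_fun_mem; move: eq_ij.
rewrite -[i]splitK -[j]splitK; case: (split i) (split j) => x [] y /=.
- by rewrite !shuffle_funl => /enum_val_inj/cast_ord_inj/perm_inj ->.
- by rewrite ltnNge leq_addr ltn_ord.
- by rewrite [k + x < k]ltnNge leq_addr ltn_ord.
- by rewrite !shuffle_funr => /enum_val_inj/cast_ord_inj/perm_inj ->.
Qed.

Definition shuffle u : 'S_(k + m) := perm (@shuffle_fun_inj u).

Lemma shuffle_inj : injective shuffle.
Proof.
move=> u v eq_uv.
have eq_f i : shuffle_fun u i = shuffle_fun v i.
  by have := congr1 (fun p : 'S__ => p i) eq_uv; rewrite !permE.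
have eq1 : u.1 = v.1.
  (* The value set is the image of the first [k] positions, so it is determined by the function. *)
  apply/val_inj/setP=> z.
  have [g _ gK] := injF_bij (@shuffle_fun_inj u).
  rewrite -[z]gK.
  by rewrite {2}eq_f !shuffle_fun_mem.
case: u v eq1 eq_f {eq_uv} => A [s t] [B [s' t']] /= <- {B} eq_f.
congr (_, (_, _)); apply/permP=> x.
  by have := eq_f (lshift m x); rewrite !shuffle_funl => /enum_val_inj/cast_ord_inj.
by have := eq_f (rshift k x); rewrite !shuffle_funr => /enum_val_inj/cast_ord_inj.
Qed.

Lemma card_ksubsets : #|{: ksubset}| = 'C(k + m, k).
Proof. by rewrite card_sig -[k + m in RHS]card_ord -card_draws cardsE. Qed.

(** Injectivity suffices, since both sides have [(k + m)!] elements. *)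
Lemma shuffle_bij : bijective shuffle.
Proof.
apply: inj_card_bij shuffle_inj _.
rewrite !card_prod card_ksubsets !card_Sn.
by rewrite -(@bin_fact (k + m) k) ?leq_addr // addKn.
Qed.

(** Every adjacent pair except the one at the seam [k.-1] lies inside one block. The disjunction
    leaves the comparison at the seam free. *)
Lemma descent_set_shuffle u (D : pred nat) : 0 < k ->
  (descent_set (shuffle u) == pattern (k + m) D)
    || (descent_set (shuffle u) == pattern (k + m) (flip k.-1 D))
  = (descent_set u.2.1 == pattern k D)
    && (descent_set u.2.2 == pattern m (fun j => D (k + j))).
Proof.
move=> k_gt0; apply/orP/andP => [hD | [/descent_set_patternP hl /descent_set_patternP hr]].
  have {hD} hD (x y : 'I_(k + m)) : y = x.+1 :> nat -> x <> k.-1 :> nat ->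
      (shuffle u y < shuffle u x) = D x.
    move=> yx /eqP/negbTE nk; case: hD => /descent_set_patternP ->; rewrite // /flip.
    by rewrite nk addbF.
  split; apply/descent_set_patternP => x y yx.
    rewrite -[RHS](hD (lshift m x) (lshift m y)) //=; last first.
      by move=> xk; have := ltn_ord y; rewrite yx xk prednK ?ltnn.
    by rewrite !permE !shuffle_funl ltn_enum_val.
  rewrite -[RHS](hD (rshift k x) (rshift k y)) //=.
  - by rewrite !permE !shuffle_funr ltn_enum_val.
  - by rewrite yx addnS.
  - by move=> xk; have := leq_addr x k; rewrite xk leqNgt prednK ?leqnn.
have hD (x y : 'I_(k + m)) : y = x.+1 :> nat -> x <> k.-1 :> nat ->
    (shuffle u y < shuffle u x) = D x.
  rewrite -[x]splitK -[y]splitK; case: (split x) (split y) => {x y} x [] y /= yx xk.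
  - by rewrite !permE !shuffle_funl ltn_enum_val -(hl _ _ yx).
  - case: xk; apply/eqP; rewrite -eqSS prednK // eqn_leq ltn_ord -yx.
    by rewrite leq_addr.
  - by have := ltn_ord y; rewrite yx ltnNge (leq_trans (leq_addr x k)).
  rewrite !permE !shuffle_funr ltn_enum_val -(hr x y) //.
  by apply/eqP; rewrite -(eqn_add2l k) yx addnS.
(* The case split is on whether the seam disagrees with [D]. It is existential because there is no
   seam pair when [m = 0]. *)
have [kn | kn] := boolP [exists x : 'I_(k + m), exists y : 'I_(k + m),
   [&& x == k.-1 :> nat, y == x.+1 :> nat & (shuffle u y < shuffle u x) (+) D x]].
  right; apply/descent_set_patternP => x y yx; rewrite /flip.
  case: eqP => [xk|xk]; last by rewrite addbF hD.
  case/existsP: kn => x' /existsP[y' /and3P[/eqP x'k /eqP y'x']].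
  have -> : x' = x by apply: val_inj; rewrite /= x'k.
  have -> : y' = y by apply: val_inj; rewrite /= y'x' x'k -xk.
  by case: (shuffle u y < _) (D x) => [] [].
left; apply/descent_set_patternP => x y yx.
case: (x =P k.-1 :> nat) => [xk|xk]; last by rewrite hD.
apply: contraNeq kn; rewrite negb_eqb => kn.
apply/existsP; exists x; apply/existsP; exists y.
by rewrite xk yx xk !eqxx -xk.
Qed.

Lemma beta_flip (D : pred nat) : 0 < k -> 0 < m ->
  beta (pattern (k + m) D) + beta (pattern (k + m) (flip k.-1 D)) =
  'C(k + m, k) * (beta (pattern k D) * beta (pattern m (fun j => D (k + j)))).
Proof.
move=> k_gt0 m_gt0; rewrite /beta -cardsUI.
(* The two classes are disjoint: their patterns differ at [k.-1], a genuine index because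
   [m > 0]. *)
set T := _ :&: _; have -> : T = set0.
  apply/setP=> pi; rewrite !inE; apply/andP=> -[/eqP-> /eqP/setP].
  have lt_k : k.-1 < (k + m).-1 by rewrite ltn_predRL prednK // -addn1 leq_add2l.
  by move/(_ (Ordinal lt_k)); rewrite !inE /flip eqxx; case: (D _).
rewrite cards0 addn0 -!cardsX.
have [g _ gK] := shuffle_bij.
rewrite -card_ksubsets -[#|{: ksubset}|]cardsT -cardsX -(card_imset _ shuffle_inj).
apply: eq_card => pi; rewrite -[pi]gK mem_imset; last exact: shuffle_inj.
by rewrite !inE descent_set_shuffle.
Qed.

End Shuffle.

Lemma beta_pattern0 n : beta (pattern n pred0) = 1.
Proof.
rewrite /beta -(cards1 (1%g : 'S_n)); apply: eq_card => pi; rewrite !inE.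
apply/descent_set_patternP/eqP => [hD | -> x y yx]; last first.
  by rewrite !perm1 yx ltnNge leqnSn.
have ge_pi i (lt_i : i < n) : i <= pi (Ordinal lt_i).
  elim: i lt_i => // i IHi lt_i; apply: leq_ltn_trans (IHi (ltnW lt_i)) _.
  rewrite ltn_neqAle [X in _ && X]leqNgt hD // andbT.
  by apply/negP=> /eqP/val_inj/perm_inj/(congr1 val)/= /n_Sn.
(* Summing [x <= pi x] over all [x] gives equal totals, since [pi] permutes the values, so equality
   holds termwise. *)
have /leqif_sum/= [_] : forall x : 'I_n, true -> x <= pi x ?= iff (x == pi x :> nat).
  by move=> x _; apply/leqifP; case: eqP => // /eqP ne_x; rewrite ltn_neqAle ne_x; case: x {ne_x}.
rewrite [X in _ == X](_ : _ = \sum_(x < n) x); last first.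
  by rewrite [RHS](reindex_inj (@perm_inj _ pi)).
rewrite eqxx => /esym/forallP fix_pi; apply/permP => x; rewrite perm1.
by apply/ord_inj; rewrite -(eqP (fix_pi x)).
Qed.

(** * Binomial coefficients in prime-power rows, and the parity of beta *)

Lemma logn_lt_exp p a k : 0 < k < p ^ a -> prime p -> logn p k < a.
Proof.
case/andP=> k_gt0 lt_k p_pr.
by rewrite -(ltn_exp2l _ _ (prime_gt1 p_pr)) (leq_ltn_trans _ lt_k) // dvdn_leq ?pfactor_dvdnn.
Qed.

(** Compare [p]-adic valuations in [k * 'C(p ^ a, k) = p ^ a * 'C((p ^ a).-1, k.-1)]. *)
Lemma dvdn_bin_exp p a b k : prime p -> 0 < k < p ^ a -> logn p k + b <= a ->
  p ^ b %| 'C(p ^ a, k).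
Proof.
move=> p_pr /andP[k_gt0 lt_k] le_b.
have C_gt0 : 0 < 'C(p ^ a, k) by rewrite bin_gt0 ltnW.
have D_gt0 : 0 < 'C((p ^ a).-1, k.-1) by rewrite bin_gt0 -!subn1 leq_sub2r // ltnW.
rewrite pfactor_dvdn // -(leq_add2l (logn p k)); apply: leq_trans le_b _.
rewrite -lognM // -[k in k * _]prednK // -[k in 'C(_, k)]prednK // -mul_bin_diag.
have pa_gt0 : 0 < p ^ a by rewrite expn_gt0 prime_gt0.
by rewrite (lognM p pa_gt0 D_gt0) pfactorK // leq_addr.
Qed.

Lemma even_bin_exp2 a k : 0 < k < 2 ^ a -> 2 %| 'C(2 ^ a, k).
Proof.
by move=> hk; apply: (@dvdn_bin_exp 2 a 1 k) => //; rewrite addn1 logn_lt_exp.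
Qed.

Lemma dvd4_bin_exp2 a k : 0 < k < 2 ^ a.+1 -> k <> 2 ^ a -> 4 %| 'C(2 ^ a.+1, k).
Proof.
move=> hk k_mid; apply: (@dvdn_bin_exp 2 a.+1 2 k) => //.
rewrite addn2 ltnS ltn_neqAle -ltnS logn_lt_exp // andbT.
(* The only positive multiple of [2 ^ a] below [2 ^ a.+1] is [2 ^ a] itself. *)
apply/eqP => log_k; case: k_mid.
have [k_gt0 lt_k] := andP hk.
have /dvdnP[q def_k] : 2 ^ a %| k by rewrite -log_k pfactor_dvdnn.
move: k_gt0 lt_k; rewrite def_k expnS ltn_pmul2r ?expn_gt0 //.
by case: q {def_k} => [|[|q]] //; rewrite mul1n.
Qed.

(** By Pascal's rule, neighbours in row [2 ^ a - 1] add up to an even entry of the next row, so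
    parity stays that of the initial 1. *)
Lemma odd_bin_pred_exp2 a j : j < 2 ^ a -> odd 'C((2 ^ a).-1, j).
Proof.
elim: j => [|j IHj] lt_j; first by rewrite bin0.
have pa_gt0 : 0 < 2 ^ a by rewrite expn_gt0.
have := @even_bin_exp2 a j.+1 lt_j; rewrite -{1}(prednK pa_gt0) binS dvdn2 oddD.
by rewrite IHj 1?ltnW // addbT negbK.
Qed.

Lemma central_bin_exp2 a : 'C(2 ^ a.+1, 2 ^ a) = 2 * 'C((2 ^ a.+1).-1, (2 ^ a).-1).
Proof.
have pa_gt0 : 0 < 2 ^ a by rewrite expn_gt0.
apply/eqP; rewrite -(eqn_pmul2l pa_gt0) -{1 2}(prednK pa_gt0).
by rewrite -mul_bin_diag mulnA -expnSr.
Qed.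

Lemma beta_flip_subn n k (D : pred nat) : 0 < k < n ->
  beta (pattern n D) + beta (pattern n (flip k.-1 D)) =
  'C(n, k) * (beta (pattern k D) * beta (pattern (n - k) (fun j => D (k + j)))).
Proof.
case/andP=> k_gt0 lt_k; have m_gt0 : 0 < n - k by rewrite subn_gt0.
by have := beta_flip D k_gt0 m_gt0; rewrite subnKC // ltnW.
Qed.

Lemma odd_beta_exp2 a (D : pred nat) : odd (beta (pattern (2 ^ a) D)).
Proof.
(* The elements of [D] are inserted in increasing order, starting from the empty set; each insertion
   is a toggle and preserves parity. *)
suff odd_cut b : b < 2 ^ a -> odd (beta (pattern (2 ^ a) (fun i => (i < b) && D i))).
  rewrite (_ : pattern _ D = pattern (2 ^ a) (fun i => (i < (2 ^ a).-1) && D i)).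
    by rewrite odd_cut // prednK // expn_gt0.
  by apply/setP=> i; rewrite !inE ltn_ord.
elim: b => [|b IHb] lt_b; first by rewrite (@eq_pattern _ _ pred0) // beta_pattern0.
have := IHb (ltnW lt_b); case Db: (D b); last first.
  rewrite (@eq_pattern _ _ (fun i => (i < b) && D i)) // => i.
  by rewrite ltnS leq_eqVlt andb_orl; case: eqP => [->|]; rewrite ?Db ?ltnn.
have /(congr1 odd) := @beta_flip_subn (2 ^ a) b.+1 (fun i => (i < b) && D i) lt_b.
rewrite oddD oddM (negbTE (_ : ~~ odd 'C(_, _))) -?dvdn2 ?even_bin_exp2 //=.
rewrite (@eq_pattern _ (flip b _) (fun i => (i < b.+1) && D i)) => [|i].
  by case: odd => [/= /negbFE|].
by rewrite /flip ltnS [i <= b]leq_eqVlt; case: eqP => [->|_]; rewrite ?ltnn ?Db ?addbF.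
Qed.

(** * Roots of unity and cyclotomic divisibility *)

Import GRing.Theory.
Local Open Scope ring_scope.

(** The cyclotomic polynomial is the minimal polynomial of [z] over the rationals. *)
Lemma Cyclotomic_rat_dvdp m (z : algC) (q : {poly rat}) : m.-primitive_root z ->
  (Cyclotomic_rat m %| q) = root (map_poly ratr q) z.
Proof.
move=> prim_z; have [p [Dp _] ->] := minCpolyP z; congr (_ %| q).
apply: (@map_poly_inj _ _ (ratr : {rmorphism rat -> algC})).
rewrite -Dp (minCpoly_cyclotomic prim_z) -(Cintr_Cyclotomic prim_z) -map_poly_comp.
by apply: eq_map_poly => c; rewrite /= ratr_int.
Qed.

Lemma prim_expr_half (R : idomainType) m (z : R) :
  (0 < m)%N -> (2 * m).-primitive_root z -> z ^+ m = -1.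
Proof.
move=> m_gt0 prim_z; have := prim_expr_order prim_z; rewrite mulnC exprM.
move/eqP; rewrite sqrf_eq1 => /orP[|/eqP//].
rewrite -(prim_order_dvd prim_z) => /dvdn_leq; rewrite m_gt0 leqNgt.
by rewrite ltn_Pmull // => /(_ isT).
Qed.

Lemma root_descent_set_poly n (z : algC) (phi : {set 'I_n.-1} -> {set 'I_n.-1}) :
  injective phi -> (forall S, z ^+ beta (phi S) = - z ^+ beta S) ->
  root (map_poly ratr (descent_set_poly n)) z.
Proof.
move=> phi_inj hphi.
have -> : root (map_poly ratr (descent_set_poly n)) z = (\sum_(S : {set 'I_n.-1}) z ^+ beta S == 0).
  rewrite /root /descent_set_poly rmorph_sum horner_sum; congr (_ == 0).
  by apply: eq_bigr => S _; rewrite /= map_polyXn hornerXn.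
(* Twice the sum is the sum plus its reindexing by [phi], which cancels termwise. *)
rewrite -[_ == 0](Num.Theory.mulrn_eq0 _ 2) mulr2n {1}(reindex_inj phi_inj) -big_split /=.
by rewrite big1 // => S _; rewrite hphi addNr.
Qed.

(** Here [x], [y], [w] stand for beta at a set, after one toggle, and after both. Writing
    [w + (x + y) = (y + w) + x] avoids subtraction of naturals. *)
Lemma prim_expr_opp (R : idomainType) (z : R) s x y w :
  odd s -> (4 * s).-primitive_root z ->
  (4 * s %| x + y)%N -> (s %| y + w)%N -> y + w = 2 %[mod 4] ->
  z ^+ w = - z ^+ x.
Proof.
move=> s_odd prim_z dvd_xy dvd_yw yw4.
have co2s : coprime 2 s by rewrite coprime2n.
have [o o_odd def_yw] : exists2 o, odd o & (y + w = 2 * s * o)%N.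
  have /dvdnP[r def_yw] : (2 * s %| y + w)%N.
    by rewrite Gauss_dvd // dvd_yw andbT /dvdn -(@modn_dvdm 4) // yw4.
  exists r; last by rewrite mulnC.
  move: yw4; rewrite def_yw mulnCA -[4%N]/(2 * 2)%N -muln_modr.
  by rewrite modn2 oddM s_odd andbT; case: odd.
have halfz : z ^+ (2 * s) = -1.
  by apply: prim_expr_half; rewrite ?mulnA // muln_gt0 (odd_gt0 s_odd).
have /(congr1 (GRing.exp z)) : (w + (x + y) = y + w + x)%N by rewrite addnC -addnA addnC.
rewrite exprD [RHS]exprD def_yw [z ^+ (_ * o)]exprM halfz -signr_odd o_odd mulN1r.
by move: dvd_xy; rewrite (prim_order_dvd prim_z) => /eqP->; rewrite mulr1.
Qed.

Local Close Scope ring_scope.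

(** The toggle is restated on sets because reindexing the sum needs an injection there, while
    different predicates can cut out the same set. *)
Definition flip_set n (i : nat) (S : {set 'I_n.-1}) : {set 'I_n.-1} :=
  [set j | (j \in S) (+) (j == i :> nat)].

Lemma flip_setK n i : involutive (@flip_set n i).
Proof. by move=> S; apply/setP=> j; rewrite !inE addbK. Qed.

Lemma pattern_flip n i D : pattern n (flip i D) = flip_set i (pattern n D).
Proof. by apply/setP=> j; rewrite !inE. Qed.

Lemma pattern_surj n (S : {set 'I_n.-1}) : exists D, S = pattern n D.
Proof.
exists (fun j => [exists i in S, val i == j]).
apply/setP=> i; rewrite inE; apply/idP/exists_inP => [Si | [j Sj /eqP/val_inj <-] //].
by exists i.
Qed.

Theorem theorem4p2 (a n s : nat)
  (ha : 2 <= a) (hn : n = 2 ^ a)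
  (s_odd : odd s) (s_gt0 : 0 < s)
  (s_central : s %| 'C(n, n %/ 2))
  (s_other : exists k : nat,
     [/\ 1 <= k <= n - 1, k <> n %/ 2 & s %| 'C(n, k)]) :
  (Cyclotomic_rat (4 * s) %| descent_set_poly n)%R.
Proof.
case: a ha hn => [|b] // b_gt0 hn; have {s_other} [k [k_bounds k_mid s_k]] := s_other.
have n2 : n %/ 2 = 2 ^ b by rewrite hn expnS mulKn.
have n_gt0 : 0 < n by rewrite hn expn_gt0.
have hk : 0 < k < n by rewrite leq_subRL in k_bounds.
have h2 : 0 < 2 ^ b < n by rewrite hn expn_gt0 ltn_exp2l /=.
rewrite n2 in s_central k_mid.
have fs_gt0 : 0 < 4 * s by rewrite muln_gt0.
have [z prim_z] := C_prim_root_exists fs_gt0.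
rewrite (Cyclotomic_rat_dvdp _ prim_z).
pose phi S := flip_set (2 ^ b).-1 (@flip_set n k.-1 S).
apply: (@root_descent_set_poly n z phi) => [|S].
  by apply: inj_comp; apply: inv_inj; apply: flip_setK.
have [D ->] := pattern_surj S; rewrite /phi -!pattern_flip.
apply: (@prim_expr_opp _ z s _ (beta (pattern n (flip k.-1 D)))) => //.
- rewrite beta_flip_subn // dvdn_mulr // Gauss_dvd ?s_k ?andbT; last first.
    by apply: (@coprimeXl 2 2); rewrite coprime2n.
  by rewrite hn; apply: dvd4_bin_exp2; rewrite -?hn.
- by rewrite beta_flip_subn // dvdn_mulr.
(* Both blocks have length [2 ^ b], so their beta factors are odd and the sum is twice an odd
   number, hence 2 modulo 4. *)
have n_sub : n - 2 ^ b = 2 ^ b by rewrite hn expnS mul2n -addnn addnK.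
rewrite beta_flip_subn // n_sub hn central_bin_exp2.
rewrite -mulnA -[4]/(2 * 2) -muln_modr modn2 !oddM !odd_beta_exp2 !andbT.
by rewrite odd_bin_pred_exp2 // (leq_ltn_trans (leq_pred _)) // ltn_exp2l.
Qed.
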